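(* Let $k\ge 1$ be an integer and let $\mathcal{R}_k=\{R_1,R_2,\dots,R_{t_k}\}$ be the fixed López-Abad list of canonical equivalence relations on $FIN_k$ described in the context. If $\mathcal{H}$ is a semiselective Gowers coideal of block sequences, then $\mathcal{H}$ has the canonical partition property: for every equivalence relation $R$ on $FIN_k$ there exist $m\in\{1,2,\dots,t_k\}$ and $A\in\mathcal{H}$ such that the restriction of $R$ to $[A]$ coincides with $R_m$ (that is, for all $a,b\in[A]$, $(a,b)\in R\Leftrightarrow (a,b)\in R_m$).
   Context: Block sequences. Let $\mathbb{N}$ be the set of nonnegative integers and fix an integer $k\ge1$. For $p:\mathbb{N}\to\{0,1,\dots,k\}$ let $supp(p)=\{n: p(n)\neq0\}$ and let $rang(p)$ be the image set of $p$. $FIN_k$ is the set of all $p:\mathbb{N}\to\{0,1,\dots,k\}$ with $supp(p)$ finite and $k\in rang(p)$. A basic block sequence is a sequence $X=(x_n)_{n\in I}$ of elements of $FIN_k$, $I\subseteq\mathbb{N}$, such that $n<m$ implies $\max(supp(x_n))<\min(supp(x_m))$; it is treated as the set of its terms when convenient. For infinite sequences $I=\mathbb{N}$ is assumed. $FIN_k^{[\infty]}$ is the set of infinite basic block sequences. Let $T(p)(n)=\max\{p(n)-1,0\}$ and let $T^{(j)}$ be the $j$-th iterate of $T$ ($T^{(0)}(p)=p$). For a basic block sequence $A=(a_n)_{n\in I}$, $[A]\subseteq FIN_k$ is the set of all functions $T^{(j_0)}(a_{n_0})+\cdots+T^{(j_r)}(a_{n_r})$ with $n_0<\cdots<n_r$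 in $I$, $j_0,\dots,j_r\in\{0,1,\dots,k\}$ and $j_i=0$ for some $i$. $A\le B$ means $A\subseteq[B]$. For $b\in FIN_k$, $A/b=\{x\in A:\max(supp(b))<\min(supp(x))\}$. Coideals. $\mathcal{H}\subseteq FIN_k^{[\infty]}$ is a coideal of block sequences if (1) $A\le B$ and $A\in\mathcal{H}$ imply $B\in\mathcal{H}$; and (2) given $A\in\mathcal{H}$ and a partition $A=B\cup C$, there exists $D\in\mathcal{H}$ such that $D\le B$ or $D\le C$. Write $\mathcal{H}\upharpoonright A=\{B\in\mathcal{H}:B\le A\}$. $\mathcal{H}$ is Gowers if for every integer $r>0$, every $A\in\mathcal{H}$ and every $f:FIN_k\to\{0,1,\dots,r-1\}$ there exists $B\in\mathcal{H}\upharpoonright A$ such that $f$ is constant on $[B]$. A set $\mathcal{D}\subseteq FIN_k^{[\infty]}$ is dense open if (I) $B\in\mathcal{D}$ and $A\le B$ imply $A\in\mathcal{D}$, and (II) for every $A\in FIN_k^{[\infty]}$ there is $B\in\mathcal{D}$ with $B\le A$. If $(A_n)_{n\ge1}$ is a decreasing sequence in $(FIN_k^{[\infty]},\le)$, then $B\in FIN_k^{[\infty]}$ is a diagonalization of $(A_n)_{n\ge1}$ (or diagonalizes it) if $B/b\le A_n$ for every $b\in[B]$ with $n=\max(supp(b))$. $\mathcal{H}$ is semiselective if, given $A\in\mathcal{H}$ and a sequence $(\mathcal{D}_n)_n$ of dense open sets with each $\mathcal{D}_n\subseteq\mathcal{H}$, there exist a decreasing sequence $(A_n)_n$ with $A_n\in\mathcal{D}_n$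 for all $n$ and $B\in\mathcal{H}\upharpoonright A$ such that $B$ diagonalizes $(A_n)_n$. Systems of staircases. For $i\le k$ and $a\in FIN_k$ put $min_i(a)=\min\{n:a(n)=i\}$ and $max_i(a)=\max\{n:a(n)=i\}$, both being $0$ if $i\notin rang(a)$; for $i=0$ the maximum of the (unbounded) set is read as $\infty$. $a\in FIN_k$ is a system of staircases (sos) if: (a) $rang(a)=\{0,1,\dots,k\}$; (b) $min_i(a)<min_j(a)<max_j(a)<max_i(a)$ for $i<j\le k$; (c) for every $1\le i\le k$, $rang(a\upharpoonright[min_{i-1}(a),min_i(a)])=\{0,1,\dots,i\}$, $rang(a\upharpoonright[max_i(a),max_{i-1}(a)])=\{0,1,\dots,i\}$ and $rang(a\upharpoonright[min_k(a),max_k(a)])=\{0,1,\dots,k\}$. $A=(a_1,a_2,\dots)\in FIN_k^{[\infty]}$ is a sos if every $a_j$ is a sos. Canonical relations. Given $A\in FIN_k^{[\infty]}$, an equivalence relation $R$ on $FIN_k$ is canonical in $[A]$ if for every sos $B\le A$ one of the following holds: for all $a,b\in[B]$, $(a,b)\in R$; or for all $a,b\in[B]$, $(a,b)\notin R$. $R$ is canonical if it is canonical in $FIN_k$. The list $\mathcal{R}_k$. By a theorem of López-Abad there is a finite collection $\mathcal{R}_k=\{R_1,R_2,\dots,R_{t_k}\}$ of canonical equivalence relations on $FIN_k$ such that for every $A\in FIN_k^{[\infty]}$ and every equivalence relation $R$ on $[A]$ there exist $m\in\{1,2,\dots,t_k\}$ and a sos $B\le A$ such that the restriction of $R$ to $[B]$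 coincides with $R_m$ (on $[B]$). Here $t_k=(k!\,e_k(1))^2+k\,(k!\,e_k(1)-(k-1)!\,e_{k-1}(1))^2$ with $e_n(1)=\sum_{j=0}^n\frac{1}{j!}$. Such a collection is fixed.
   Formalization: The coideal is assumed nonempty, and dense open sets in the definition of semiselective are taken relative to the coideal (open and dense within it), since density below every block sequence would make semiselectivity vacuous for every proper coideal. *)

(* Defs.v *)
(* Plain MathComp, with the classical sets of MathComp-Analysis. *)
From mathcomp Require Import all_boot all_order all_algebra.
From mathcomp Require Import boolp classical_sets cardinality.

Set Implicit Arguments.
Unset Strict Implicit.
Unset Printing Implicit Defensive.

Import Order.TTheory GRing.Theory Num.Theory.
Local Open Scope classical_set_scope.
Local Open Scope nat_scope.

(** Vectors [p : nat -> nat] and sequences of vectors; the bound [p n <= k]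
    is part of membership in [FIN k]. *)
Definition vec := nat -> nat.
Definition vseq := nat -> vec.

(** Both are [0] when the minimum (resp. maximum) does not exist. *)
Definition set_min (S : set nat) : nat :=
  xget 0 [set n | S n /\ forall m, S m -> n <= m].
Definition set_max (S : set nat) : nat :=
  xget 0 [set n | S n /\ forall m, S m -> m <= n].

Definition supp (p : vec) : set nat := [set n | p n != 0].
Definition min_supp (p : vec) : nat := set_min (supp p).
Definition max_supp (p : vec) : nat := set_max (supp p).

Definition FIN (k : nat) : set vec :=
  [set p | [/\ forall n, p n <= k, finite_set (supp p) & range p k]].

(** [nat] predecessor is truncated: [T p n = max (p n - 1) 0]. *)
Definition T (p : vec) : vec := fun n => (p n).-1.

(** The set of infinite basic block sequences of elements of [FIN k]. *)
Definition FINoo (k : nat) : set vseq :=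
  [set A | (forall n, FIN k (A n)) /\
           forall n m, n < m -> max_supp (A n) < min_supp (A m)].

(** [comb k I A] is [[(A n)_{n in I}]], for a subsequence of [A] indexed by a
    finite or infinite [I]; the exponents are indexed by the terms used, and
    the addition of vectors is pointwise. *)
Definition comb (k : nat) (I : set nat) (A : vseq) : set vec :=
  [set p | exists (s : seq nat) (j : nat -> nat),
    [/\ sorted ltn s,
        forall n, n \in s -> I n /\ j n <= k,
        exists2 n, n \in s & j n = 0
      & p = fun x => \sum_(n <- s) iter (j n) T (A n) x]].

Definition span (k : nat) (A : vseq) : set vec := comb k setT A.

Definition ble (k : nat) (A B : vseq) : Prop := range A `<=` span k B.

(** The set of terms of [A / b]. *)
Definition tail (A : vseq) (b : vec) : set vec :=
  [set A n | n in [set n | max_supp b < min_supp (A n)]].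

(** In the second clause, [I] and [J] index the two parts of the partition of
    the terms of [A]. *)
Definition coideal (k : nat) (H : set vseq) : Prop :=
  [/\ H `<=` FINoo k,
      forall A B, FINoo k B -> ble k A B -> H A -> H B
    & forall A (I J : set nat), H A -> I `|` J = setT -> I `&` J = set0 ->
        exists2 D, H D &
          range D `<=` comb k I A \/ range D `<=` comb k J A].

Definition gowers (k : nat) (H : set vseq) : Prop :=
  forall (r : nat) (A : vseq) (f : vec -> 'I_r), 0 < r -> H A ->
    exists B, [/\ H B, ble k B A &
      exists c : 'I_r, forall p, span k B p -> f p = c].

(** Subsets of [H] that are open and dense in the poset [(H, <=)].  Both
    quantifiers range over [H]: a subset of [H] that is dense below every
    element of [FINoo k] exists only if [H = FINoo k], by upward closure. *)
Definition dense_open (k : nat) (H D : set vseq) : Prop :=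
  [/\ D `<=` H,
      forall A B, D B -> H A -> ble k A B -> D A
    & forall A, H A -> exists2 B, D B & ble k B A].

(** Sequences are indexed by the positive integers; the value at [0] is
    irrelevant. *)
Definition decreasing (k : nat) (As : nat -> vseq) : Prop :=
  forall m n, 0 < m -> m <= n -> ble k (As n) (As m).

Definition diagonalizes (k : nat) (B : vseq) (As : nat -> vseq) : Prop :=
  forall b, span k B b -> 0 < max_supp b ->
    tail B b `<=` span k (As (max_supp b)).

Definition semiselective (k : nat) (H : set vseq) : Prop :=
  forall (A : vseq) (D : nat -> set vseq), H A ->
    (forall n, 0 < n -> dense_open k H (D n)) ->
    exists (As : nat -> vseq) (B : vseq),
      [/\ forall n, 0 < n -> D n (As n), decreasing k As,
          H B, ble k B A & diagonalizes k B As].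

Definition min_at (i : nat) (a : vec) : nat := set_min [set n | a n = i].
Definition max_at (i : nat) (a : vec) : nat := set_max [set n | a n = i].

(** [n] is below the last occurrence of [i], which is at infinity for
    [i = 0]. *)
Definition le_max_at (n i : nat) (a : vec) : Prop := i = 0 \/ n <= max_at i a.
Definition lt_max_at (n i : nat) (a : vec) : Prop := i = 0 \/ n < max_at i a.

(** Systems of staircases. *)
Definition sos_vec (k : nat) (a : vec) : Prop :=
  [/\ FIN k a,
      range a = [set v | v <= k],
      forall i j, i < j -> j <= k ->
        [/\ min_at i a < min_at j a, min_at j a < max_at j a
          & lt_max_at (max_at j a) i a]
    & forall i, 0 < i -> i <= k ->
        [/\ a @` [set n | min_at i.-1 a <= n <= min_at i a] = [set v | v <= i],
            a @` [set n | max_at i a <= n /\ le_max_at n i.-1 a]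
              = [set v | v <= i]
          & a @` [set n | min_at k a <= n <= max_at k a] = [set v | v <= k]]].

Definition sos (k : nat) (A : vseq) : Prop := forall n, sos_vec k (A n).

Definition equivalence_on (S : set vec) (R : vec -> vec -> Prop) : Prop :=
  [/\ forall a, S a -> R a a,
      forall a b, S a -> S b -> R a b -> R b a
    & forall a b c, S a -> S b -> S c -> R a b -> R b c -> R a c].

Definition coincide_on (S : set vec) (R R' : vec -> vec -> Prop) : Prop :=
  forall a b, S a -> S b -> (R a b <-> R' a b).

(** [k! e_k(1)]; each [j!] with [j <= k] divides [k!]. *)
Definition fact_e (k : nat) : nat := \sum_(j < k.+1) k`! %/ j`!.

Definition lopez_abad_count (k : nat) : nat :=
  fact_e k ^ 2 + k * (fact_e k - fact_e k.-1) ^ 2.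

Lemma lopez_abad_countE (k : nat) : 0 < k ->
  let e n : rat := (\sum_(j < n.+1) (j`!%:R)^-1)%R in
  ((lopez_abad_count k)%:R =
     (k`!%:R * e k) ^+ 2
     + k%:R * (k`!%:R * e k - (k.-1)`!%:R * e k.-1) ^+ 2)%R.
Proof.
move=> k0 /=.
have E n : ((fact_e n)%:R = n`!%:R * (\sum_(j < n.+1) (j`!%:R)^-1) :> rat)%R.
  rewrite /fact_e natr_sum mulr_sumr; apply: eq_bigr => j _.
  have jn : j`! %| n`!.
    by rewrite -(@bin_fact n j) -1?ltnS // mulnCA dvdn_mulr.
  by rewrite natf_div.
have le : fact_e k.-1 <= fact_e k.
  case: k k0 => // k _ /=; rewrite /fact_e [X in _ <= X]big_ord_recr /=.
  apply: leq_trans (leq_addr _ _); apply: leq_sum => j _.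
  by apply: leq_div2r; rewrite factS leq_pmull.
by rewrite /lopez_abad_count natrD natrM !natrX natrB // !E.
Qed.

(** The defining property of the fixed list of equivalence relations: on every
    block sequence, every equivalence relation is one of them after passing to
    a system of staircases. *)
Definition lopez_abad_list (k t : nat) (Rs : 'I_t -> vec -> vec -> Prop) :
    Prop :=
  (forall m, equivalence_on (FIN k) (Rs m)) /\
  forall (A : vseq) (R : vec -> vec -> Prop),
    FINoo k A -> equivalence_on (span k A) R ->
    exists (m : 'I_t) (B : vseq),
      [/\ FINoo k B, sos k B, ble k B A & coincide_on (span k B) R (Rs m)].

(** "Canonical" relations in the sense that [R] is constantly true or constantly
    false on every system of staircases.  Because equivalence relations are
    reflexive, this forces [R] to be full there, so no list with the property
    above consists of such relations ([canonical_list_absurd]); canonicity is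
    therefore not made part of [lopez_abad_list], which covers every list with
    the stated property, whatever notion of canonicity it satisfies. *)
Definition canonical (k : nat) (R : vec -> vec -> Prop) : Prop :=
  forall B, FINoo k B -> sos k B ->
    (forall a b, span k B a -> span k B b -> R a b) \/
    (forall a b, span k B a -> span k B b -> ~ R a b).

Lemma span_term (k : nat) (A : vseq) (n : nat) : span k A (A n).
Proof.
exists [:: n], (fun=> 0); split => //.
- by exists n => //; rewrite mem_head.
- by apply: funext => x; rewrite big_seq1.
Qed.

Lemma set_max1 (n : nat) : set_max [set n] = n.
Proof.
rewrite /set_max; case: xgetP => [x _ [] //|/(_ n) []].
by split => // m ->.
Qed.

Lemma set_min1 (n : nat) : set_min [set n] = n.
Proof.
rewrite /set_min; case: xgetP => [x _ [] //|/(_ n) []].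
by split => // m ->.
Qed.

Lemma FINoo_neq0 (k : nat) : 0 < k -> FINoo k !=set0.
Proof.
move=> k0; pose A : vseq := fun n x => if x == n then k else 0.
have sA n : supp (A n) = [set n].
  apply/seteqP; split => x; rewrite /supp /A /=; first by case: (x =P n).
  by move=> ->; rewrite eqxx -lt0n.
exists A; split => [n|n m nm]; last first.
  by rewrite /max_supp /min_supp !sA set_max1 set_min1.
split; first by move=> x; rewrite /A; case: eqP.
- by rewrite sA; exact: finite_set1.
- by exists n => //; rewrite /A eqxx.
Qed.

Lemma min_supp_le_max_supp (k : nat) (p : vec) :
  0 < k -> FIN k p -> min_supp p <= max_supp p.
Proof.
move=> k0 [_ /finite_seqP[D sD] [x _ xk]].
have Sx : supp p x by move: k0; rewrite -xk lt0n.
have exD : exists n, n \in D by exists x; move: Sx; rewrite sD.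
have ubD n : n \in D -> n <= \max_(i <- D) i.
  by move=> nD; apply: (@leq_bigmax_seq _ _ predT id).
have [M MD Mub] := ex_maxnP exD ubD.
have [m mD mlb] := ex_minnP exD.
rewrite /min_supp /max_supp sD /set_max.
case: xgetP => [M' _ [SM _]|/(_ M) []//].
rewrite /set_min; case: xgetP => [l _ [_ /(_ _ SM)]//|/(_ m) []//].
Qed.

Lemma canonical_list_absurd (k t : nat) (Rs : 'I_t -> vec -> vec -> Prop) :
  0 < k -> lopez_abad_list k Rs -> (forall m, canonical k (Rs m)) -> False.
Proof.
move=> k0 [_ LA] can; have [A AF] := FINoo_neq0 k0.
have eqE : equivalence_on (span k A) eq by split=> // a b c _ _ _ -> ->.
have [m [B [BF Bs _ co]]] := LA _ _ AF eqE.
have B0 := span_term k B 0; have B1 := span_term k B 1.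
have E : B 0 = B 1.
  case: (can m B BF Bs) => h; first by apply/co => //; apply: h.
  by case: (h _ _ B0 B0); apply/co.
have := BF.2 0 1 isT.
by rewrite E ltnNge (min_supp_le_max_supp k0 (BF.1 1)).
Qed.

(* Main.v *)
(** For each [m], the block sequences [C] such that [R] and [Rs m] differ on [[C]]
    form an open set [O m], since a disagreement involves finitely many terms of
    [C].  A Galvin-Prikry style combinatorial forcing inside [H], with
    semiselectivity as the fusion principle and the Gowers property as the
    pigeonhole, shows that open sets are Ramsey relative to [H].  If no element of
    [H] realizes any [Rs m], applying this to each [O m] in turn gives [X] in [H]
    all of whose block subsequences lie in every [O m], which contradicts the
    Lopez-Abad theorem applied to [X]. *)
Require Import Defs.
From mathcomp Require Import all_boot.
From mathcomp Require Import boolp classical_sets.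
From mathcomp Require Import cardinality zify.

Local Open Scope classical_set_scope.
Local Open Scope nat_scope.

(** * Supports and the block order *)

Definition block_lt (p q : vec) : Prop :=
  forall x y, p x != 0 -> q y != 0 -> x < y.

Lemma iter_TE (j : nat) (p : vec) (x : nat) : iter j T p x = p x - j.
Proof. by elim: j => [|j IH] /=; rewrite ?subn0 // /T IH subnS. Qed.

Lemma FINP (k : nat) (p : vec) :
  FIN k p <-> [/\ forall x, p x <= k, exists M, forall x, M <= x -> p x = 0
                & exists x, p x = k].
Proof.
split=> [[ple /finite_seqP[D sD] [x _ xk]]|[ple [M pM] [x xk]]].
  split=> //; last by exists x.
  exists (\max_(i <- D) i).+1 => x' xM; apply/eqP/negPn/negP => px.
  have : [set` D] x' by rewrite -sD.
  move=> /= xD; have := @leq_bigmax_seq _ _ predT id _ xD isT.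
  by rewrite leqNgt xM.
split=> //; last by exists x.
apply: (sub_finite_set (B := `I_M)); last exact: finite_II.
by move=> y /=; rewrite /supp /= ltnNge => /eqP py; apply/negP => /pM.
Qed.

Section FixedHeight.
Variable k : nat.
Hypothesis k_gt0 : 0 < k.

Lemma max_suppP (p : vec) : FIN k p ->
  p (max_supp p) != 0 /\ forall x, p x != 0 -> x <= max_supp p.
Proof.
move=> /FINP[_ [M pM] [x xk]].
have exS : exists x, p x != 0 by exists x; rewrite xk -lt0n.
have ub y : p y != 0 -> y <= M.
  by move=> py; rewrite leqNgt; apply/negP => /ltnW/pM/eqP; apply/negP.
have [m pm mub] := ex_maxnP exS ub.
by rewrite /max_supp /set_max; case: xgetP => [z _ []//|/(_ m) []].
Qed.

Lemma min_suppP (p : vec) : FIN k p ->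
  p (min_supp p) != 0 /\ forall x, p x != 0 -> min_supp p <= x.
Proof.
move=> /FINP[_ _ [x xk]].
have exS : exists x, p x != 0 by exists x; rewrite xk -lt0n.
have [m pm mlb] := ex_minnP exS.
by rewrite /min_supp /set_min; case: xgetP => [z _ []//|/(_ m) []].
Qed.

Lemma block_ltP (p q : vec) : FIN k p -> FIN k q ->
  max_supp p < min_supp q <-> block_lt p q.
Proof.
move=> pF qF; have [pM pub] := max_suppP p pF; have [qm qlb] := min_suppP q qF.
split=> [h x y /pub xM /qlb my|h]; last exact: h.
exact: leq_ltn_trans xM (leq_trans h my).
Qed.

Lemma FINoo_block_lt (A : vseq) (n m : nat) :
  FINoo k A -> n < m -> block_lt (A n) (A m).
Proof. by move=> [AF Alt] /Alt /block_ltP; apply. Qed.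

Lemma FINoo_le (A : vseq) (n x : nat) : FINoo k A -> A n x <= k.
Proof. by move=> [AF _]; have /FINP[] := AF n. Qed.

Lemma FINoo_top (A : vseq) (n : nat) : FINoo k A -> exists x, A n x = k.
Proof. by move=> [AF _]; have /FINP[] := AF n. Qed.

Lemma FINoo_disj (A : vseq) (n m x : nat) :
  FINoo k A -> A n x != 0 -> A m x != 0 -> n = m.
Proof.
move=> AF An Am; have [nm|mn|//] := ltngtP n m.
- by have := FINoo_block_lt A n m AF nm x x An Am; rewrite ltnn.
- by have := FINoo_block_lt A m n AF mn x x Am An; rewrite ltnn.
Qed.

(** * Spans described by exponent functions *)

Lemma comb_sum (A : vseq) (s : seq nat) (j : nat -> nat) (n x : nat) :
  FINoo k A -> uniq s -> A n x != 0 ->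
  \sum_(m <- s) iter (j m) T (A m) x = if n \in s then A n x - j n else 0.
Proof.
move=> AF us An.
have z m : m != n -> iter (j m) T (A m) x = 0.
  move=> mn; rewrite iter_TE; have [->//|Am] := eqVneq (A m x) 0.
  by move: mn; rewrite (FINoo_disj A m n x) ?eqxx.
case: ifP => ns.
  by rewrite (bigD1_seq n) //= iter_TE big1 ?addn0 // => m /z.
by rewrite big1_seq // => m /= ms; apply: z; apply: contraTneq ms => ->; rewrite ns.
Qed.

(* Disjointness of supports turns the sum into a condition on each [A n]; an
   unused term gets the exponent [k], which annihilates it. *)
Lemma spanP (A : vseq) (p : vec) : FINoo k A ->
  span k A p <-> exists (j : nat -> nat) (N : nat),
    [/\ forall n, N <= n -> j n = k, forall n, j n <= k, exists n, j n = 0,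
        forall n x, A n x != 0 -> p x = A n x - j n
      & forall x, (forall n, A n x = 0) -> p x = 0].
Proof.
move=> AF; split.
  move=> [s [j [ss jk [n0 n0s j0] ->]]].
  have us : uniq s := sorted_uniq ltn_trans ltnn ss.
  exists (fun n => if n \in s then j n else k), (\max_(i <- s) i).+1; split.
  - move=> n nN; case: ifP => // ns.
    by have := @leq_bigmax_seq _ _ predT id _ ns isT; rewrite leqNgt nN.
  - by move=> n; case: ifP => // /jk [].
  - by exists n0; rewrite n0s.
  - move=> n x An; rewrite (comb_sum A s j n x) //; case: ifP => // _.
    by apply/esym/eqP; rewrite subn_eq0 FINoo_le.
  - by move=> x A0; rewrite big1 // => n _; rewrite iter_TE A0.
move=> [j [N [jN jk [n0 j0] pA p0]]].
exists (iota 0 N), j; split.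
- exact: iota_ltn_sorted.
- by move=> n _; split.
- exists n0 => //; rewrite mem_iota /= add0n ltnNge; apply/negP => /jN.
  by rewrite j0 => k0; move: k_gt0; rewrite -k0.
- apply: funext => x.
  have [[n An]|/forallNP A0] := pselect (exists n, A n x != 0).
    rewrite (comb_sum A _ j n x) ?iota_uniq // mem_iota /= add0n (pA _ _ An).
    case: ltnP => // /jN ->; by apply/eqP; rewrite subn_eq0 FINoo_le.
  have {}A0 n : A n x = 0 by apply/eqP/negPn/negP; exact: A0.
  by rewrite p0 // big1 // => n _; rewrite iter_TE A0.
Qed.

Lemma span_FIN (A : vseq) (p : vec) : FINoo k A -> span k A p -> FIN k p.
Proof.
move=> AF /spanP -/(_ AF) [j [N [jN jk [n0 j0] pA p0]]]; apply/FINP; split.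
- move=> x; have [[n An]|/forallNP A0] := pselect (exists n, A n x != 0).
    rewrite (pA _ _ An); exact: leq_trans (leq_subr _ _) (FINoo_le A n x AF).
  by rewrite p0 // => n; apply/eqP/negPn/negP; exact: A0.
- exists (max_supp (A N)).+1 => x xM.
  have [[n An]|/forallNP A0] := pselect (exists n, A n x != 0); last first.
    by rewrite p0 // => n; apply/eqP/negPn/negP; exact: A0.
  rewrite (pA _ _ An) jN; first by apply/eqP; rewrite subn_eq0 FINoo_le.
  have [Am Aub] := max_suppP (A N) (AF.1 N).
  rewrite leqNgt; apply/negP => nN.
  have := FINoo_block_lt A n N AF nN x _ An Am.
  by rewrite ltnNge ltnW.
- have [x Ax] := FINoo_top A n0 AF; exists x.
  by rewrite (pA n0) ?Ax -?lt0n // j0 subn0.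
Qed.

(** Iterates of [T] compose, so exponents add, truncated at [k]. No clash arises, because each term
    of [A] survives in at most one term of [B]. *)
Lemma span_trans (A B : vseq) (p : vec) : FINoo k A -> FINoo k B ->
  ble k B A -> span k B p -> span k A p.
Proof.
move=> AF BF BA /spanP -/(_ BF) [j [N [jN jk [n0 j0] pB p0]]].
have /choice [l] : forall n, exists l : nat -> nat,
    [/\ exists M, forall m, M <= m -> l m = k, forall m, l m <= k,
        exists m, l m = 0, forall m x, A m x != 0 -> B n x = A m x - l m
      & forall x, (forall m, A m x = 0) -> B n x = 0].
  move=> n; have /spanP -/(_ AF) [l [M [lM lk l0 BAm B0]]] : span k A (B n).
    by apply: BA; exists n.
  by exists l; split=> //; exists M.
move=> lP.
have /choice [M MP] : forall n, exists M, forall m, M <= m -> l n m = k.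
  by move=> n; have [] := lP n.
have lk n m : l n m <= k by have [] := lP n.
have lB n m x : A m x != 0 -> B n x = A m x - l n m by have [_ _ _ h _] := lP n; exact: h.
(* At a point where [A m] takes the value [k], both [B n] and [B n'] are nonzero. *)
have l_inj m n n' : l n m < k -> l n' m < k -> n = n'.
  move=> ln ln'; have [x Ax] := FINoo_top A m AF.
  have A0 : A m x != 0 by rewrite Ax -lt0n.
  by apply: (FINoo_disj B n n' x) => //; rewrite (lB _ m) // Ax -lt0n subn_gt0.
(* [e] is the total exponent of [A m] in [p]: the sum along the unique [B n] that uses [A m], or [k]
   if there is none. *)
have /choice [e eP] : forall m, exists e,
    (exists2 n, l n m < k & e = minn k (l n m + j n)) \/
    (forall n, l n m = k) /\ e = k.
  move=> m; have [[n ln]|/forallNP lge] := pselect (exists n, l n m < k).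
    by exists (minn k (l n m + j n)); left; exists n.
  by exists k; right; split=> // n; apply/eqP; rewrite eqn_leq lk leqNgt; apply/negP.
apply/spanP => //; exists e, (\max_(n < N) M n); split.
- move=> m mM; case: (eP m) => [[n ln ->]|[]//].
  have [nN|/jN ->] := ltnP n N; last by lia.
  have := leq_trans (@leq_bigmax_cond _ predT (fun i : 'I_N => M i) (Ordinal nN) isT) mM.
  by move=> /MP ->; lia.
- by move=> m; case: (eP m) => [[n ln ->]|[_ ->//]]; rewrite geq_minl.
- have [_ _ [m l0] _ _] := lP n0; exists m.
  case: (eP m) => [[n ln ->]|[lge _]].
    by rewrite (l_inj m n n0) ?l0 ?j0 ?minn0.
  by move: k_gt0; rewrite -(lge n0) l0.
- move=> m x Am; have Ak := FINoo_le A m x AF.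
  case: (eP m) => [[n ln ->]|[lge ->]]; last first.
    rewrite p0; first by lia.
    by move=> n; rewrite (lB n m) // lge; lia.
  have [Bn0|Bn] := eqVneq (B n x) 0; last first.
    by rewrite (pB n) // (lB n m) //; lia.
  rewrite p0; first by move: Bn0; rewrite (lB n m) //; lia.
  move=> n'; have [<-//|n'n] := eqVneq n n'.
  rewrite (lB n' m) //; apply/eqP; rewrite subn_eq0; apply: leq_trans Ak _.
  by rewrite leqNgt; apply: contra_neqN n'n => /(l_inj m n n' ln).
- by move=> x A0; rewrite p0 // => n; have [_ _ _ _ h] := lP n; exact: h.
Qed.

Lemma ble_refl (A : vseq) : ble k A A.
Proof. by move=> _ [n _ <-]; exact: span_term. Qed.

Lemma ble_trans {A B C : vseq} : ble k C B -> ble k B A ->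
  FINoo k A -> FINoo k B -> ble k C A.
Proof. by move=> CB BA AF BF p /CB /(span_trans A B p AF BF BA). Qed.

Definition shift (A : vseq) (n : nat) : vseq := fun i => A (n + i).

Lemma shift_FINoo (A : vseq) (n : nat) : FINoo k A -> FINoo k (shift A n).
Proof. by move=> [AF Alt]; split=> [i|i j ij]; [exact: AF|apply: Alt; rewrite ltn_add2l]. Qed.

Lemma shift_ble (A B : vseq) (n : nat) : ble k A B -> ble k (shift A n) B.
Proof. by move=> AB _ [i _ <-]; apply: AB; exists (n + i). Qed.

(** A vector [c] lying after [b] can only use terms of [B] past the last one that [b] uses, and all
    of those belong to [tail B b]. *)
Lemma span_tail (B Z : vseq) (b c : vec) : FINoo k B -> FINoo k Z ->
  span k B b -> tail B b `<=` span k Z -> span k B c -> block_lt b c ->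
  span k Z c.
Proof.
move=> BF ZF bB tZ cB bc; have bF := span_FIN B b BF bB.
have [jb [N [jN jk [n0 j0] bE b0]]] := (spanP B b BF).1 bB.
have [jc [N' [j'N j'k [n1 j'0] cE c0]]] := (spanP B c BF).1 cB.
have lt0 : exists n, jb n < k by exists n0; rewrite j0.
have ub n : jb n < k -> n <= N.
  by move=> nk; rewrite leqNgt; apply/negP => /ltnW/jN nE; rewrite nE ltnn in nk.
(* [m] is the index of the last term of [B] that [b] uses with a nonzero contribution. *)
have [m jm mub] := ex_maxnP lt0 ub.
have top n (j : nat -> nat) p : (forall n x, B n x != 0 -> p x = B n x - j n) ->
    j n < k -> exists2 x, B n x != 0 & p x != 0.
  move=> pE jn; have [x Bx] := FINoo_top B n BF; have Bx0 : B n x != 0 by rewrite Bx -lt0n.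
  by exists x => //; rewrite (pE n) // Bx -lt0n subn_gt0.
have jcm n : n <= m -> jc n = k.
  move=> nm; apply/eqP; rewrite eqn_leq j'k leqNgt /=; apply/negP => jn.
  have [x Bx cx] := top n jc c cE jn; have [y By yb] := top m jb b bE jm.
  have yx := bc y x yb cx; move: nm; rewrite leq_eqVlt => /orP[/eqP nm|nm].
    have [y' By'] := FINoo_top B m BF; subst n.
    have By0 : B m y' != 0 by rewrite By' -lt0n.
    have := bc y' y'; rewrite (bE m) // (cE m) // By' -!lt0n !subn_gt0 ltnn.
    by move=> /(_ jm jn).
  by have := FINoo_block_lt B n m BF nm x y Bx By; rewrite ltnNge ltnW.
have SF := shift_FINoo B m.+1 BF.
apply: (span_trans Z (shift B m.+1)) => //.
  move=> _ [i _ <-]; apply: tZ; exists (m.+1 + i) => //=.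
  apply/(block_ltP b) => //; first exact: BF.1.
  move=> x y bx By.
  have [[n An]|/forallNP A0] := pselect (exists n, B n x != 0); last first.
    by move: bx; rewrite b0 // => n; apply/eqP/negPn/negP; exact: A0.
  have nm : n <= m.
    apply: mub; move: bx; rewrite (bE n) // -lt0n subn_gt0 => bx.
    exact: leq_trans bx (FINoo_le B n x BF).
  apply: (FINoo_block_lt B n (m.+1 + i) BF _ x y) => //.
  by rewrite addSn ltnS (leq_trans nm) ?leq_addr.
apply/spanP => //; exists (fun i => jc (m.+1 + i)), N'; split=> //.
- by move=> n nN; apply: j'N; rewrite (leq_trans nN) ?leq_addl.
- exists (n1 - m.+1); rewrite subnKC // ltnNge; apply/negP => /jcm.
  by rewrite j'0 => k0; move: k_gt0; rewrite -k0.
- by move=> n x; exact: cE.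
- move=> x B0; have [[n Bn]|/forallNP A0] := pselect (exists n, B n x != 0); last first.
    by rewrite c0 // => n; apply/eqP/negPn/negP; exact: A0.
  rewrite (cE n) // jcm; first by apply/eqP; rewrite subn_eq0 FINoo_le.
  rewrite leqNgt; apply/negP => mn; move: Bn (B0 (n - m.+1)).
  by rewrite /shift subnKC // => /eqP.
Qed.


(** * Finite block sequences and their finite coding *)

Fixpoint prepend (s : seq vec) (C : vseq) : vseq :=
  if s is b :: s' then prepend s' (fun n => if n is n'.+1 then C n' else b)
  else C.

Fixpoint initial (C : vseq) (n : nat) : seq vec :=
  if n is n'.+1 then C n' :: initial C n' else [::].

Lemma prepend_initial (C C' : vseq) (n i : nat) :
  prepend (initial C n) C' i = if i < n then C i else C' (i - n).
Proof.
elim: n C' => [|n IH] C' /=; first by rewrite subn0.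
rewrite IH ltnS; case: ltngtP => // [ni|->]; last by rewrite subnn.
by rewrite -(subnSK ni).
Qed.

(* Finite block sequences are listed in decreasing order, last block first. *)
Definition follows (s : seq vec) (p : vec) : Prop :=
  if s is b :: _ then block_lt b p else True.

Fixpoint stem (s : seq vec) : Prop :=
  if s is b :: s' then [/\ FIN k b, follows s' b & stem s'] else True.

(** Maxima of supports strictly increase along a stem. Hence only finitely many stems have a last
    block with a given [max_supp], which lets [fusion] treat them all at one index. *)
Lemma stem_bound (b : vec) (s : seq vec) : stem (b :: s) ->
  size s <= max_supp b /\
  forall i x, i <= size s -> max_supp b < x -> nth (fun=> 0) (b :: s) i x = 0.
Proof.
elim: s b => [|c s IH] b [bF].
  move=> _ _; split=> // -[|//] x _ xb /=.
  by apply/eqP/negPn/negP => /(max_suppP b bF).2; rewrite leqNgt xb.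
move=> cb cs; have [cF _ _] := cs; have [sc nc] := IH c cs.
have lt_cb : max_supp c < max_supp b.
  by apply: cb; [have [] := max_suppP c cF|have [] := max_suppP b bF].
split=> [|[|i] x ile xb]; first exact: leq_ltn_trans sc lt_cb.
  by apply/eqP/negPn/negP => /(max_suppP b bF).2; rewrite leqNgt xb.
by apply: nc => //; apply: ltn_trans xb.
Qed.

Lemma stem_FIN (s : seq vec) (i : nat) :
  stem s -> i < size s -> FIN k (nth (fun=> 0) s i).
Proof. by elim: s i => //= b s IH [|i] [bF _ ss] //; exact: IH. Qed.

(** A finite type of codes whose values include every nonempty stem supported in [[0, n]]; some
    codes decode to no stem. *)
Definition stem_decode (n : nat) (g : n.+1.-bseq {ffun 'I_n.+1 -> 'I_k.+1}) :
    seq vec :=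
  [seq (fun x => if x <= n then (f : {ffun 'I_n.+1 -> 'I_k.+1}) (inord x) : nat else 0)
    | f <- g].

Lemma stem_decode_surj (n : nat) (b : vec) (s : seq vec) :
  stem (b :: s) -> max_supp b <= n ->
  exists g : n.+1.-bseq {ffun 'I_n.+1 -> 'I_k.+1}, stem_decode n g = b :: s.
Proof.
move=> st bn; have [sz zero] := stem_bound b s st.
pose enc (v : vec) := [ffun i : 'I_n.+1 => inord (v i) : 'I_k.+1].
have gsz : size (map enc (b :: s)) <= n.+1.
  by rewrite size_map /= ltnS (leq_trans sz).
exists (Bseq gsz); rewrite /stem_decode -[bseqval _]/(map enc (b :: s)) -map_comp.
apply: (@eq_from_nth _ (fun=> 0)); rewrite size_map // => i ilt.
rewrite (nth_map (fun=> 0)) //=; apply: funext => x.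
have /FINP[vk _ _] := stem_FIN (b :: s) i st ilt.
case: leqP => xn; first by rewrite ffunE !inordK ?ltnS.
by rewrite zero // (leq_ltn_trans bn).
Qed.

(** * Pigeonhole and fusion inside [H] *)

Section Ramsey.
Variable H : set vseq.
Hypotheses (HF : H `<=` FINoo k) (Hss : semiselective k H) (HG : gowers k H).

Lemma gowers_color (X : vseq) (P : vec -> Prop) : H X ->
  exists Y, [/\ H Y, ble k Y X &
    (forall p, span k Y p -> P p) \/ (forall p, span k Y p -> ~ P p)].
Proof.
move=> HX; have [Y [HY YX [c cY]]] :=
  HG 2 X (fun p => if `[< P p >] then ord_max else ord0) (ltn0Sn 1) HX.
exists Y; split=> //; have [PY|nPY] := asboolP (P (Y 0)); [left|right] => p pY.
- have := cY p pY; rewrite -(cY (Y 0) (span_term k Y 0)) (asboolT PY).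
  by case: asboolP => // _ /(congr1 val).
- have := cY p pY; rewrite -(cY (Y 0) (span_term k Y 0)) (asboolF nPY).
  by case: asboolP => // _ /(congr1 val).
Qed.

Lemma FINoo_max_supp (X : vseq) (n : nat) : FINoo k X -> n <= max_supp (X n).
Proof.
move=> XF; elim: n => // n IH; apply: leq_ltn_trans IH _.
apply: (FINoo_block_lt X n n.+1 XF) => //.
- exact: (max_suppP _ (XF.1 n)).1.
- exact: (max_suppP _ (XF.1 n.+1)).1.
Qed.

Lemma beyond (X : vseq) (M : nat) : H X -> exists Y,
  [/\ H Y, ble k Y X & forall p x, span k Y p -> p x != 0 -> M < x].
Proof.
move=> HX.
have [Y [HY YX [hY|hY]]] := gowers_color X (fun p => forall x, p x != 0 -> M < x) HX.
  by exists Y; split=> // p x /hY; apply.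
(* The negative colour is impossible: [Y M.+1] starts after [max_supp (Y M)], which is at least
   [M]. *)
case: (hY (Y M.+1) (span_term k Y _)) => x Yx.
have YF := HF _ HY; apply: leq_ltn_trans (FINoo_max_supp Y M YF) _.
by apply: (FINoo_block_lt Y M M.+1 YF) => //; exact: (max_suppP _ (YF.1 M)).1.
Qed.

Lemma beyond_vec (X : vseq) (b : vec) : H X -> FIN k b -> exists Y,
  [/\ H Y, ble k Y X & forall p, span k Y p -> block_lt b p].
Proof.
move=> HX bF; have [Y [HY YX YM]] := beyond X (max_supp b) HX.
exists Y; split=> // p pY x y /(max_suppP b bF).2 xb /(YM p y pY).
exact: leq_ltn_trans.
Qed.

Lemma dense_open_finite (G : finType) (E : G -> set vseq) :
  (forall g, dense_open k H (E g)) ->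
  dense_open k H [set X | H X /\ forall g, E g X].
Proof.
move=> Edo; split=> [X []//|X Y [_ EY] HX XY|X HX].
  by split=> // g; have [_ open _] := Edo g; apply: open XY.
suff [Y [HY YX EY]] : exists Y, [/\ H Y, ble k Y X & forall g, g \in enum G -> E g Y].
  by exists Y => //; split=> // g; apply: EY; rewrite mem_enum.
elim: (enum G) => [|g s [Y [HY YX EY]]].
  by exists X; split=> //; exact: ble_refl.
have [sub _ dense] := Edo g; have [Z EZ ZY] := dense Y HY; have HZ := sub Z EZ.
exists Z; split=> //; first by apply: ble_trans ZY YX _ _; exact: HF.
move=> g'; rewrite inE => /orP[/eqP ->//|g's].
by have [_ open _] := Edo g'; apply: open (EY _ g's) HZ ZY.
Qed.

(* The form in which semiselectivity is used; [Z] plays the role of the [n]-th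
   term of the diagonalized sequence, [n = max_supp b]. *)
Lemma fusion (E : seq vec -> set vseq) :
  (forall s, stem s -> dense_open k H (E s)) ->
  forall X, H X -> exists Y, [/\ H Y, ble k Y X &
    forall b s, stem (b :: s) -> span k Y b -> exists Z, [/\ E (b :: s) Z, H Z &
      forall c, span k Y c -> block_lt b c -> span k Z c]].
Proof.
(* Diagonalization says nothing at index [0]; moving past [0] makes every [max_supp b] positive. *)
move=> Edo X HX; have [X' [HX' X'X X'0]] := beyond X 0 HX.
(* The guard keeps [E' n g] dense open when [g] does not code a stem. *)
pose E' n g := [set Z | H Z /\ (stem (stem_decode n g) -> E (stem_decode n g) Z)].
have E'do n : dense_open k H [set Z | H Z /\ forall g, E' n g Z].
  apply: dense_open_finite => g.
  have [st|nst] := pselect (stem (stem_decode n g)).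
    have [sub open dense] := Edo _ st; split=> [Z []//|Z Y [HY EY] HZ ZY|Z HZ].
      by split=> // _; apply: open ZY => //; exact: EY.
    by have [Y EY YZ] := dense Z HZ; exists Y => //; split=> //; exact: sub.
  split=> [Z []//|//|Z HZ]; exists Z => //; exact: ble_refl.
have [As [Y [EAs _ HY YX' diagY]]] :=
  Hss X' (fun n => [set Z | H Z /\ forall g, E' n g Z]) HX' (fun n _ => E'do n).
have [X'F XF YF] := And3 (HF _ HX') (HF _ HX) (HF _ HY).
exists Y; split=> //; first exact: ble_trans YX' X'X _ _.
move=> b s st bY; have bF := span_FIN Y b YF bY.
have b0 : 0 < max_supp b.
  apply: (X'0 b); last exact: (max_suppP b bF).1.
  exact: (span_trans X' Y).
have [HZ EZ] := EAs _ b0; exists (As (max_supp b)); split=> //.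
  have [g gE] := stem_decode_surj (max_supp b) b s st (leqnn _).
  by have [_] := EZ g; rewrite gE; apply.
move=> c cY bc; apply: (span_tail Y _ b c) => //; first exact: HF.
exact: diagY.
Qed.

(** * Combinatorial forcing for an open set *)

Variable O : set vseq.
Hypothesis O_open : forall C, O C ->
  exists n, forall C', (forall i, i < n -> C' i = C i) -> O C'.

(* [C] ranges over all of [FINoo k], not only over [H]: a sequence accepting
   [[::]] has all its block subsequences in [O]. *)
Definition accepts (X : vseq) (s : seq vec) : Prop :=
  forall C, FINoo k C -> ble k C X -> (forall i, follows s (C i)) ->
    O (prepend s C).

Definition rejects (X : vseq) (s : seq vec) : Prop :=
  forall Y, H Y -> ble k Y X -> ~ accepts Y s.

Lemma accepts_le {X Y : vseq} {s : seq vec} : accepts X s -> ble k Y X ->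
  FINoo k X -> FINoo k Y -> accepts Y s.
Proof. by move=> aX YX XF YF C CF CY; apply: aX => //; exact: ble_trans CY YX _ _. Qed.

Lemma rejects_le {X Y : vseq} {s : seq vec} : rejects X s -> ble k Y X ->
  FINoo k X -> FINoo k Y -> rejects Y s.
Proof. by move=> rX YX XF YF Z HZ ZY; apply: rX => //; exact: ble_trans ZY YX _ _. Qed.

(** A [W] below [Y] accepting [s] could be refined in [H] to lie after [b]; it would then be below
    [Z] and still accept [s]. *)
Lemma rejects_beyond {Y Z : vseq} {b : vec} {s : seq vec} :
  (forall c, span k Y c -> block_lt b c -> span k Z c) ->
  rejects Z s -> H Y -> H Z -> FIN k b -> rejects Y s.
Proof.
move=> YZ rZ HY HZ bF W HW WY aW.
have [V [HV VW bV]] := beyond_vec W b HW bF.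
have [YF WF VF] := And3 (HF _ HY) (HF _ HW) (HF _ HV).
apply: (rZ V) => //; last exact: accepts_le aW VW _ _.
move=> c cV; have cV' : span k V c by case: cV => n _ <-; exact: span_term.
apply: YZ; last exact: bV.
by apply: (span_trans Y W) => //; exact: VW.
Qed.

(** Acceptance of [b :: s] only tests continuations all of whose blocks follow [b], and those below
    [Y] are below [Z]. *)
Lemma accepts_beyond {Y Z : vseq} {b : vec} {s : seq vec} :
  (forall c, span k Y c -> block_lt b c -> span k Z c) ->
  accepts Z (b :: s) -> accepts Y (b :: s).
Proof.
move=> YZ aZ C CF CY bC; apply: aZ => // _ [n _ <-].
by apply: YZ (bC n); apply: CY; exists n.
Qed.

Definition decides (s : seq vec) : set vseq :=
  [set X | H X /\ (accepts X s \/ rejects X s)].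

Lemma decides_dense_open (s : seq vec) : dense_open k H (decides s).
Proof.
split=> [X []//|X Y [HY [aY|rY]] HX XY|X HX].
- by split=> //; left; apply: accepts_le aY XY _ _; exact: HF.
- by split=> //; right; apply: rejects_le rY XY _ _; exact: HF.
have [[Y [HY YX aY]]|nX] := pselect (exists Y, [/\ H Y, ble k Y X & accepts Y s]).
  by exists Y => //; split=> //; left.
exists X; last exact: ble_refl.
by split=> //; right=> Y HY YX aY; apply: nX; exists Y.
Qed.

Lemma decides_successors (X : vseq) : H X -> exists Y, [/\ H Y, ble k Y X &
  forall b s, stem (b :: s) -> span k Y b -> decides (b :: s) Y].
Proof.
move=> HX; have [Y [HY YX fY]] := fusion decides (fun s _ => decides_dense_open s) X HX.
exists Y; split=> // b s st bY; have [Z [[_ dZ] HZ YZ]] := fY b s st bY.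
have YF := HF _ HY; split=> //; case: dZ => [aZ|rZ]; [left|right].
- exact: accepts_beyond YZ aZ.
- by apply: rejects_beyond YZ rZ _ _ _ => //; case: st.
Qed.

(** Strengthens [decides] so that rejection passes to every one-block extension; this drives the
    induction in [open_ramsey]. *)
Definition settles (s : seq vec) : set vseq :=
  [set X | H X /\ (accepts X s \/
    rejects X s /\
    forall b, span k X b -> follows s b -> rejects X (b :: s))].

(** Once [s] is rejected and all its one-block extensions are decided, colour [b] by acceptance of
    [b :: s]. A homogeneous set of accepted blocks would make [s] itself accepted, so all extensions
    are rejected. *)
Lemma settles_dense_open (s : seq vec) : stem s -> dense_open k H (settles s).
Proof.
move=> st; split=> [X []//|X Y [HY aY] HX XY|X HX].
  have [XF YF] := conj (HF _ HX) (HF _ HY); split=> //.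
  case: aY => [aY|[rY rbY]]; first by left; exact: accepts_le aY XY _ _.
  right; split; first exact: rejects_le rY XY _ _.
  move=> b bX sb; apply: (rejects_le (rbY b _ sb) XY) => //.
  exact: (span_trans Y X).
have [_ _ dense] := decides_dense_open s.
have [X1 [HX1 [aX1|rX1]] X1X] := dense X HX.
  by exists X1 => //; split=> //; left.
have [X2 [HX2 X21 dX2]] := decides_successors X1 HX1.
have [X3 [HX3 X32 cX3]] := gowers_color X2 (fun b => accepts X2 (b :: s)) HX2.
have [XF X1F X2F X3F] := And4 (HF _ HX) (HF _ HX1) (HF _ HX2) (HF _ HX3).
have X31 : ble k X3 X1 := ble_trans X32 X21 X1F X2F.
exists X3; last exact: ble_trans X31 X1X _ _.
split=> //; case: cX3 => [aX3|naX3]; last first.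
  right; split; first exact: rejects_le rX1 X31 _ _.
  move=> b bX3 sb; have bX2 := span_trans X2 X3 b X2F X3F X32 bX3.
  have stb : stem (b :: s) by split=> //; exact: span_FIN bX3.
  have [_ [aX2|rX2]] := dX2 b s stb bX2; first by case: (naX3 b bX3).
  exact: rejects_le rX2 X32 _ _.
case: (rX1 X3 HX3 X31) => C CF CX3 sC.
(* The first block of the continuation is moved into the stem, where the colour of [C 0] applies. *)
have -> : prepend s C = prepend (C 0 :: s) (shift C 1).
  by congr prepend; apply: funext => -[].
apply: aX3.
- by apply: CX3; exists 0.
- exact: shift_FINoo.
- by apply: shift_ble; exact: ble_trans CX3 X32 _ _.
- by move=> i; exact: FINoo_block_lt.
Qed.

(** If [[::]] is rejected, rejection spreads to all initial segments of any [C] below [Y]. Were [C]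
    in [O], openness would make some initial segment accepted by [Y]. *)
Theorem open_ramsey (X : vseq) : H X -> exists Y, [/\ H Y, ble k Y X &
  (forall C, FINoo k C -> ble k C Y -> O C) \/
  (forall C, FINoo k C -> ble k C Y -> ~ O C)].
Proof.
move=> HX; have [_ _ dense] := settles_dense_open [::] I.
have [X1 [HX1 [aX1|[rX1 rbX1]]] X1X] := dense X HX.
  by exists X1; split=> //; left=> C CF CX1; exact: aX1.
have [Y [HY YX1 fY]] := fusion settles settles_dense_open X1 HX1.
have [XF X1F YF] := And3 (HF _ HX) (HF _ HX1) (HF _ HY).
exists Y; split=> //; first exact: ble_trans YX1 X1X _ _.
right=> C CF CY OC; have [n nO] := O_open C OC.
have CYi i : span k Y (C i) by apply: CY; exists i.
have stC i : stem (initial C i).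
  elim: i => //= i IH; split=> //; first exact: CF.1.
  by case: i {IH} => //= i; exact: FINoo_block_lt.
have rC i : rejects Y (initial C i).
  elim: i => [|i IH]; first exact: rejects_le rX1 YX1 _ _.
  (* [fusion] only handles nonempty stems, so the step from [[::]] to [[:: C 0]] uses [X1]
     instead. *)
  case: i IH => [_|i IH].
    apply: (rejects_le (rbX1 (C 0) _ _) YX1) => //.
    exact: (span_trans X1 Y).
  have [Z [[_ sZ] HZ YZ]] := fY (C i) (initial C i) (stC i.+1) (CYi i).
  have lt_i : block_lt (C i) (C i.+1) by exact: FINoo_block_lt.
  apply: (rejects_beyond YZ _ HY HZ (CF.1 i)).
  case: sZ => [aZ|[_]]; last by apply=> //; exact: YZ.
  case: (IH Y HY (ble_refl Y)); exact: accepts_beyond YZ aZ.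
apply: (rC n Y HY (ble_refl Y)) => C' _ _ _; apply: nO => i ilt.
by rewrite prepend_initial ilt.
Qed.

End Ramsey.
End FixedHeight.

(** * Transfer to equivalence relations *)

Lemma span_finite (k : nat) (C : vseq) (p : vec) : span k C p ->
  exists n, forall C', (forall i, i < n -> C' i = C i) -> span k C' p.
Proof.
move=> [s [j [ss jk j0 ->]]]; exists (\max_(i <- s) i).+1 => C' CC'.
exists s, j; split=> //; apply: funext => x; apply: eq_big_seq => i si.
by rewrite CC' // ltnS (@leq_bigmax_seq _ _ predT id).
Qed.

Theorem theorem12 (k : nat)
    (Rs : 'I_(lopez_abad_count k) -> vec -> vec -> Prop) (H : set vseq) :
  1 <= k ->
  lopez_abad_list k Rs ->
  coideal k H -> H !=set0 ->
  semiselective k H ->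
  gowers k H ->
  forall R : vec -> vec -> Prop, equivalence_on (FIN k) R ->
    exists (m : 'I_(lopez_abad_count k)) (A : vseq),
      H A /\ coincide_on (span k A) R (Rs m).
Proof.
move=> k0 [_ LA] [HF _ _] [X0 HX0] Hss HG R [Rr Rs' Rt].
apply: contrapT => none.
pose O m : set vseq := [set C | ~ coincide_on (span k C) R (Rs m)].
have O_open m C : O m C -> exists n, forall C', (forall i, i < n -> C' i = C i) -> O m C'.
  rewrite /O /= => OC.
  have [[a [b [aC bC nab]]]|no] := pselect (exists a b,
      [/\ span k C a, span k C b & ~ (R a b <-> Rs m a b)]); last first.
    by case: OC => a b aC bC; apply: contrapT => nab; apply: no; exists a, b.
  have [na haC] := span_finite k C a aC; have [nb hbC] := span_finite k C b bC.
  exists (maxn na nb) => C' CC' co; apply: nab; apply: co.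
    by apply: haC => i ilt; apply: CC'; rewrite leq_max ilt.
  by apply: hbC => i ilt; apply: CC'; rewrite leq_max ilt orbT.
have [X [HX noX]] : exists X, H X /\ forall m, m \in enum 'I_(lopez_abad_count k) ->
    forall C, FINoo k C -> ble k C X -> O m C.
  elim: (enum _) => [|m s [X [HX IH]]]; first by exists X0.
  have [Y [HY YX [OY|nOY]]] := open_ramsey k k0 H HF Hss HG (O m) (O_open m) X HX.
    exists Y; split=> // m'; rewrite inE => /orP[/eqP ->//|m's] C CF CY.
    apply: IH => //; by apply: (ble_trans k k0 CY YX); exact: HF.
  (* In the other alternative [Y] itself is outside [O m], so [R] agrees with [Rs m] on its span. *)
  case: none; exists m, Y; split=> //; apply: contrapT.
  by apply: nOY; [exact: HF|exact: ble_refl].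
have XF := HF _ HX; have spF p : span k X p -> FIN k p by exact: span_FIN.
have eqX : equivalence_on (span k X) R.
  by split=> [a /spF/Rr//|a b /spF aF /spF bF|a b c /spF aF /spF bF /spF cF];
    [exact: Rs'|exact: Rt].
(* [B] need not lie in [H]; the contradiction arises because [noX] covers every block sequence below
   [X]. *)
have [m [B [BF _ BX co]]] := LA X R XF eqX.
by apply: (noX m) BX co; rewrite ?mem_enum.
Qed.
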